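(* Let $n$ and $k$ be integers with $3 \le k \le n$. Let $G_{n,k} = K_n - E(C_k)$ be the graph obtained from the complete graph $K_n$ on $n$ vertices by deleting the $k$ edges of a simple cycle $C_k$ of length $k$ in $K_n$. Then $G_{n,k}$ admits a convex outside-obstacle representation (OOR) if and only if $k \in \{3, 4, n\}$.
   Context: All graphs are finite and simple. A straight-line drawing $\Gamma$ of a graph $G$ maps the vertices to pairwise distinct points of $\mathbb{R}^2$ and each edge to the closed line segment between its endpoints. The outer face of $\Gamma$ is the unbounded connected component of the complement in $\mathbb{R}^2$ of the union of all vertex points and edge segments. A non-edge of $G$ is a pair of distinct non-adjacent vertices; it is identified with the line segment between its endpoints. An outside-obstacle representation (OOR) of $G$ is a straight-line drawing of $G$ such that no edge segment contains a vertex point other than its two endpoints and every non-edge segment intersects the outer face of the drawing. (Equivalently, $G$ is the visibility graph of the point set with respect to a single obstacle, namely the open outer face of the drawing.) An OOR is convex if the vertex points are in convex position, i.e., each vertex point is a corner of the convex hull of all vertex points. *)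

(* Defs.v *)
From mathcomp Require Import all_boot all_order all_algebra.
From mathcomp Require Import all_classical all_reals all_analysis.
Set Implicit Arguments.
Unset Strict Implicit.
Unset Printing Implicit Defensive.
Import Order.TTheory GRing.Theory Num.Theory.
Import numFieldNormedType.Exports.
Local Open Scope classical_set_scope.
Local Open Scope ring_scope.

Section Plane.
Variable R : realType.
Implicit Types (p q z : R * R) (S : set (R * R)).

Definition segment p q : set (R * R) :=
  [set (1 - t) *: p + t *: q | t in `[0, 1]].

Definition convex_hull S : set (R * R) :=
  \bigcap_(C in [set C : set (R * R) | convex_set C /\ S `<=` C]) C.

(* A corner of a convex set is an extreme point of it. *)
Definition corner S z : Prop :=
  S z /\ forall p q (t : R), S p -> S q -> 0 < t < 1 ->
    z = (1 - t) *: p + t *: q -> p = z /\ q = z.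

End Plane.

Section Representation.
Variables (R : realType) (V : finType).

(* Graphs are given by their adjacency relation, which is expected to be
   symmetric and irreflexive. *)
Implicit Types (e : rel V) (f : V -> R * R).

Definition drawing_set e f : set (R * R) :=
  range f `|` [set z | exists x y, e x y /\ segment (f x) (f y) z].

(* The drawing being compact, its complement has exactly one unbounded
   component, so this is a single component. *)
Definition outer_face e f : set (R * R) :=
  [set z | (~` drawing_set e f) z /\
           ~ bounded_set (connected_component (~` drawing_set e f) z)].

Definition outside_obstacle_rep e f : Prop :=
  [/\ injective f,
      forall x y z, e x y -> segment (f x) (f y) (f z) -> z = x \/ z = y
    & forall x y, x != y -> ~~ e x y ->
        segment (f x) (f y) `&` outer_face e f !=set0].

Definition convex_position f : Prop :=
  forall x, corner (convex_hull (range f)) (f x).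

Definition has_convex_OOR e : Prop :=
  exists f, outside_obstacle_rep e f /\ convex_position f.

End Representation.

Arguments has_convex_OOR R [V] e.

(* The edges of the cycle c (a duplicate-free sequence of length at least 3)
   are the pairs of cyclically consecutive elements. As next fixes every
   element outside c, x != y makes both tests false there. *)
Definition complete_minus_cycle (V : finType) (c : seq V) : rel V :=
  [rel x y | [&& x != y, next c x != y & next c y != x]].

Lemma complete_minus_cycle_sym (V : finType) (c : seq V) :
  symmetric (complete_minus_cycle c).
Proof. by move=> x y; rewrite /complete_minus_cycle /= eq_sym [X in _ && X]andbC. Qed.

Lemma complete_minus_cycle_irr (V : finType) (c : seq V) :
  irreflexive (complete_minus_cycle c).
Proof. by move=> x; rewrite /complete_minus_cycle /= eqxx. Qed.

(* Main.v *)
(* Necessity.  Let w be a vertex outside the cycle c and order the vertices of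
   c by angle around w, which is a linear order since the points are in convex
   position.  If x < u < y with xy a non-edge but xu and uy edges, then the
   segment xy is the diagonal of the quadrilateral x w y u with all four sides
   in the drawing, so it misses the outer face.  Apply this to the least vertex
   a of c, its c-neighbours p < q, and the other c-neighbour j of p: when
   k >= 5, the pairs aj, pq and qj are edges.  If j < q, the non-edge aq is
   blocked by u := j; if q < j, the non-edge pj is blocked by u := q.
   Sufficiency.  Place the vertices on the parabola y = x^2 with abscissas
   0, 1, 2, ...: along c if k = n, with c_0, c_1, c_2 first if k = 3, and with
   c_0, c_1, c_3, c_2 first if k = 4.  Every non-edge contains a point from which
   a vertical ray avoids the drawing. *)
Require Import Defs.
From mathcomp Require Import all_boot all_order all_algebra.
From mathcomp Require Import all_classical all_reals all_analysis.
From mathcomp Require Import ring lra zify.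
Set Implicit Arguments.
Unset Strict Implicit.
Unset Printing Implicit Defensive.
Import Order.TTheory GRing.Theory Num.Theory.
Import numFieldNormedType.Exports.
Local Open Scope classical_set_scope.
Local Open Scope ring_scope.

(** * Orientation of triples, and bounded components inside quadrilaterals *)

Section Orientation.
Variable R : realType.
Implicit Types p q r x y z u w : R * R.

(** Twice the signed area of the triangle [p q r], positive when it runs counterclockwise. *)
Definition orient p q r : R :=
  (q.1 - p.1) * (r.2 - p.2) - (q.2 - p.2) * (r.1 - p.1).

Lemma orient_rot p q r : orient q r p = orient p q r.
Proof. by rewrite /orient; ring. Qed.

Lemma orient_swap p q r : orient q p r = - orient p q r.
Proof. by rewrite /orient; ring. Qed.

Lemma orientC p q r : orient p r q = - orient p q r.
Proof. by rewrite /orient; ring. Qed.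

Lemma orient_add x y u z :
  orient y u z + orient u x z + orient x y z = orient x y u.
Proof. by rewrite /orient; ring. Qed.

(** Barycentric coordinates of [z] as signed areas. Keeping them undivided makes the identity valid
    for degenerate triangles too; by [orient_add] the weights sum to [orient x y u]. *)
Lemma barycentric x y u z :
  orient x y u *: z = orient y u z *: x + orient u x z *: y + orient x y z *: u.
Proof.
rewrite /orient; case: x y u z => [x1 x2] [y1 y2] [u1 u2] [z1 z2].
by congr pair; rewrite /=/GRing.scale/=; ring.
Qed.

Lemma segmentP p q z :
  segment p q z <-> exists2 t, 0 <= t <= 1 & z = (1 - t) *: p + t *: q.
Proof.
split=> [[t /=]|[t t01 ->]]; last by exists t; rewrite //= in_itv.
by rewrite in_itv /= => t01 <-; exists t.
Qed.

Lemma segmentC p q : segment p q = segment q p.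
Proof.
have sub p' q' : segment p' q' `<=` segment q' p'.
  move=> z /segmentP[t t01 ->]; apply/segmentP; exists (1 - t); first by lra.
  by rewrite subKr addrC.
by apply/seteqP; split; exact: sub.
Qed.

Lemma segment_left p q : segment p q p.
Proof. by apply/segmentP; exists 0; rewrite ?subr0 ?scale1r ?scale0r ?addr0 ?lexx ?ler01. Qed.

Lemma segment_right p q : segment p q q.
Proof. by rewrite segmentC; exact: segment_left. Qed.

Lemma segment_weights p q z (a b c : R) : 0 <= a -> 0 <= b -> 0 < c ->
  a + b = c -> c *: z = a *: p + b *: q -> segment p q z.
Proof.
move=> a0 b0 c0 abc zE; apply/segmentP; exists (b / c).
  by rewrite divr_ge0 ?(ltW c0) //= ler_pdivrMr // mul1r -abc lerDr.
have -> : 1 - b / c = a / c by rewrite -abc; field; rewrite abc gt_eqF.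
rewrite ![_ / c]mulrC -!scalerA -scalerDr -zE scalerA mulVf ?scale1r //.
by rewrite gt_eqF.
Qed.

Lemma orient_segment p q z w t : z = (1 - t) *: p + t *: q ->
  (orient q w z = (1 - t) * orient p q w) * (orient w p z = t * orient p q w) *
  (orient p q z = 0).
Proof.
move=> ->; case: p q w => [p1 p2] [q1 q2] [w1 w2].
by rewrite /orient /=/GRing.scale/=; do !split; ring.
Qed.

(** The barycentric weight at [x] vanishes, which leaves a convex combination of [y] and [u]. *)
Lemma triangle_side x y u z : 0 < orient x y u ->
    orient y u z = 0 -> 0 <= orient u x z -> 0 <= orient x y z ->
  segment y u z.
Proof.
move=> d0 a0 b0 c0; apply: (segment_weights b0 c0 d0).
  by rewrite -(orient_add x y u z) a0 add0r.
by rewrite barycentric a0 scale0r add0r.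
Qed.

Lemma triangle_side' x y u z : 0 < orient x y u ->
    orient u x z = 0 -> 0 <= orient y u z -> 0 <= orient x y z ->
  segment x u z.
Proof.
rewrite -(orient_rot x y u) segmentC => d0 b0 a0 c0.
exact: triangle_side d0 b0 c0 a0.
Qed.

Lemma triangle_norm x y u z : 0 < orient x y u ->
    0 <= orient y u z -> 0 <= orient u x z -> 0 <= orient x y z ->
  `|z| <= `|x| + `|y| + `|u|.
Proof.
move=> d0 a0 b0 c0; rewrite -(ler_pM2l d0) -{1}(gtr0_norm d0) -normrZ barycentric.
rewrite (le_trans (ler_normD _ _)) // mulrDr lerD //; last first.
  rewrite normrZ ger0_norm // ler_wpM2r // -(orient_add x y u z).
  by lra.
rewrite (le_trans (ler_normD _ _)) // mulrDr lerD // normrZ ger0_norm // ler_wpM2r //.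
  by rewrite -(orient_add x y u z); lra.
by rewrite -(orient_add x y u z); lra.
Qed.

Lemma continuous_orient x y : continuous (orient x y : R * R -> R).
Proof.
move=> z; rewrite /orient; apply: cvgB; apply: cvgM.
- exact: cvg_cst.
- by apply: cvgB; [exact: cvg_snd | exact: cvg_cst].
- exact: cvg_cst.
- by apply: cvgB; [exact: cvg_fst | exact: cvg_cst].
Qed.

Lemma open_orient x y : open [set z | 0 < orient x y z].
Proof.
by apply: (open_comp (D := [set t : R | 0 < t])) => [z _|];
  [exact: continuous_orient | exact: open_gt].
Qed.

Lemma closed_orient x y : closed [set z | 0 <= orient x y z].
Proof.
by apply: (preimage_closed (D := [set t : R | 0 <= t])) => [z _|];
  [exact: continuous_orient | exact: closed_ge].
Qed.

(** The set [A] meets [K] and [F] in the same nonempty set, which is thus open and closed in [A],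
    hence all of [A]. *)
Lemma connected_clopen_sub (T : topologicalType) (A K F : set T) a :
    connected A -> open K -> closed F -> K `<=` F -> A `&` F `<=` K ->
  A a -> K a -> A `<=` F.
Proof.
move=> Ac Ko Fc KF AFK Aa Ka.
have AKF : A `&` K = A `&` F.
  by apply/seteqP; split=> z [Az Kz]; split=> //; [exact: KF | exact: AFK].
rewrite -(Ac (A `&` F)); first by [].
- by exists a; split=> //; exact: KF.
- by exists K.
- by exists F.
Qed.

Lemma bounded_norm_le (A : set (R * R)) (M : R) :
  (forall z, A z -> `|z| <= M) -> bounded_set A.
Proof.
move=> AM; exists M; split; first exact: num_real.
by move=> N MN z /AM zM; exact: le_trans zM (ltW MN).
Qed.

(* The quadrilateral x w y u need not be convex: its two triangles are glued
   along the open diagonal, so only the four sides have to be in D. *)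
Lemma quadrilateral_component_bounded (D : set (R * R)) x y u w z :
    0 < orient x y u -> 0 < orient y x w ->
    segment x u `<=` D -> segment u y `<=` D ->
    segment x w `<=` D -> segment w y `<=` D ->
  segment x y z -> ~ D z -> bounded_set (connected_component (~` D) z).
Proof.
move=> du dw Dxu Duy Dxw Dwy xyz Dz.
have Dx : D x by exact/Dxu/segment_left.
have Dy : D y by exact/Duy/segment_right.
(* [Ui] and [Wi] are the open wedges with apexes [u] and [w]. [F] is the union of the two closed
   triangles. [K] consists of their interiors together with the intersection of the wedges, an open
   set that contains the open diagonal. *)
pose Ui p := 0 < orient y u p /\ 0 < orient u x p.
pose Wi p := 0 < orient x w p /\ 0 < orient w y p.
pose K : set (R * R) :=
  [set p | [\/ 0 < orient x y p /\ Ui p, 0 < orient y x p /\ Wi p | Ui p /\ Wi p]].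
pose F : set (R * R) :=
  [set p | (0 <= orient x y p /\ (0 <= orient y u p /\ 0 <= orient u x p)) \/
           (0 <= orient y x p /\ (0 <= orient x w p /\ 0 <= orient w y p))].
have oU : open Ui by apply: openI; exact: open_orient.
have oW : open Wi by apply: openI; exact: open_orient.
have oK : open K.
  have -> : K = ([set p | 0 < orient x y p] `&` Ui) `|`
                ([set p | 0 < orient y x p] `&` Wi) `|` (Ui `&` Wi).
    apply/seteqP; split=> p /=; first by case; tauto.
    by case; [case|]; [constructor 1|constructor 2|constructor 3].
  apply: openU; last exact: openI.
  by apply: openU; apply: openI => //; exact: open_orient.
have cF : closed F.
  by apply: closedU; do !apply: closedI; exact: closed_orient.
(* On the line through [x] and [y], the weights relative to the two triangles are proportional with
   positive factors, so both wedges cut out the same points there. *)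
have line p : orient x y p = 0 ->
    (orient x w p * orient x y u = orient u x p * orient y x w) *
    (orient w y p * orient x y u = orient y u p * orient y x w).
  move=> p0; split.
    apply/eqP; rewrite -subr_eq0.
    have -> : orient x w p * orient x y u - orient u x p * orient y x w =
      orient x y p * orient u x w by rewrite /orient; ring.
    by rewrite p0 mul0r.
  apply/eqP; rewrite -subr_eq0.
  have -> : orient w y p * orient x y u - orient y u p * orient y x w =
     orient x y p * orient y u w by rewrite /orient; ring.
  by rewrite p0 mul0r.
have UW p : orient x y p = 0 -> Ui p <-> Wi p.
  move=> /line[e1 e2].
  rewrite /Ui /Wi -(pmulr_lgt0 _ dw) -e2 (pmulr_lgt0 _ du) -(pmulr_lgt0 (orient u x p) dw).
  by rewrite -e1 (pmulr_lgt0 _ du); tauto.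
have KF : K `<=` F.
  rewrite /K /F /Ui /Wi => p /=; rewrite (orient_swap x y p).
  move=> [[? []]|[? []]|[[? ?] [? ?]]] *; [left|right|]; try by rewrite !ltW.
  by case: (leP 0 (orient x y p)) => h; [left|right]; rewrite !ltW // oppr_gt0.
(* A point of [F] off [D] lies on none of the four sides, so only its weight against the diagonal
   can vanish; in that case [UW] puts it in both wedges. *)
have FKD p : F p -> ~ D p -> K p.
  have pos (q : R) : 0 <= q -> q != 0 -> 0 < q by rewrite lt_def => -> ->.
  case=> [[c [a b]]|[c [a b]]] Dp.
    have Up : Ui p.
      split; apply: pos => //; apply/negP => /eqP e; apply: Dp.
        by apply: Duy; rewrite segmentC; exact: triangle_side du e b c.
      by apply: Dxu; exact: triangle_side' du e a c.
    have [c0|c0] := eqVneq (orient x y p) 0; last by constructor 1; split=> //; exact: pos.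
    by constructor 3; split=> //; apply/UW.
  have Wp : Wi p.
    split; apply: pos => //; apply/negP => /eqP e; apply: Dp.
      by apply: Dxw; apply: triangle_side dw e b c.
    by apply: Dwy; rewrite segmentC; exact: triangle_side' dw e a c.
  have [c0|c0] := eqVneq (orient y x p) 0; last by constructor 2; split=> //; exact: pos.
  constructor 3; split=> //; apply/UW => //.
  by apply: oppr_inj; rewrite -orient_swap c0 oppr0.
apply: (@bounded_norm_le _ (`|x| + `|y| + (`|u| + `|w|))) => p zp.
suff: F p.
  case=> [[a [b c]]|[a [b c]]].
    apply: le_trans (triangle_norm du b c a) _.
    by rewrite lerD2l lerDl.
  apply: le_trans (triangle_norm dw b c a) _.
  by rewrite [`|y| + `|x|]addrC lerD2l lerDr.
move: p zp; apply: (@connected_clopen_sub _ _ K F z) => //.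
- exact: component_connected.
- by move=> p [/connected_component_sub ? Fp]; exact: FKD.
- exact: connected_component_refl.
apply: FKD Dz.
case/segmentP: xyz => t t01 /(orient_segment u) [[e1 e2] e3].
left; rewrite e1 e2 e3 lexx !mulr_ge0 ?(ltW du) //; lra.
Qed.
End Orientation.

(** * Orientations of points in convex position *)

Section ConvexPosition.
Variable R : realType.
Implicit Types (S : set (R * R)) (p q z : R * R).

Lemma subset_convex_hull S : S `<=` convex_hull S.
Proof. by move=> z Sz C [_]; exact. Qed.

Lemma convex_hull_combination S p q (t : R) : convex_hull S p -> convex_hull S q ->
  0 <= t <= 1 -> convex_hull S ((1 - t) *: p + t *: q).
Proof.
move=> Sp Sq /andP[t0 t1] C CS; have [cC _] := CS.
have := cC q p (Itv01 t0 t1); rewrite !inE => /(_ (Sq _ CS) (Sp _ CS)).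
by rewrite /conv /= addrC.
Qed.

Lemma corner_combination S p q z (a b : R) : corner (convex_hull S) z ->
    convex_hull S p -> convex_hull S q -> 0 < a -> 0 <= b ->
  (a + b) *: z = a *: p + b *: q -> p = z.
Proof.
move=> [_ ext] Sp Sq a0; rewrite le_eqVlt => /predU1P[<-|b0] zE.
  move: zE; rewrite addr0 scale0r addr0 => /scalerI -> //; exact: lt0r_neq0.
have ab0 : 0 < a + b by exact: addr_gt0.
apply: (ext p q (b / (a + b)) Sp Sq _ _).1.
  by rewrite divr_gt0 //= ltr_pdivrMr // mul1r ltrDr.
have -> : 1 - b / (a + b) = a / (a + b) by field; exact: lt0r_neq0.
rewrite ![_ / (a + b)]mulrC -!scalerA -scalerDr -zE scalerA mulVf ?scale1r //.
exact: lt0r_neq0.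
Qed.

(** The points [q] and [r] merge into one hull point of weight [b + c], which reduces to a
    combination of two points. *)
Lemma corner_combination3 S p q r z (a b c : R) : corner (convex_hull S) z ->
    S p -> S q -> S r -> 0 < a -> 0 <= b -> 0 <= c ->
  (a + b + c) *: z = a *: p + b *: q + c *: r -> p = z.
Proof.
move=> cz Sp Sq Sr a0 b0; rewrite le_eqVlt => /predU1P[<-|c0] zE.
  move: zE; rewrite addr0 scale0r addr0; apply: (corner_combination cz) => //.
  - by apply: subset_convex_hull.
  - by apply: subset_convex_hull.
have bc0 : 0 < b + c by exact: ltr_wpDl.
apply: (@corner_combination S p ((1 - c / (b + c)) *: q + (c / (b + c)) *: r) _ a (b + c) cz).
- by apply: subset_convex_hull.
- apply: convex_hull_combination; try by apply: subset_convex_hull.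
  by rewrite divr_ge0 ?(ltW c0) ?(ltW bc0) //= ler_pdivrMr // mul1r lerDr.
- by [].
- exact: ltW.
rewrite addrA zE -addrA; congr (_ + _).
rewrite scalerDr !scalerA mulrBr mulr1 mulrCA divff ?mulr1 ?addrK //.
exact: lt0r_neq0.
Qed.

Variables (V : finType) (f : V -> R * R).
Hypotheses (f_inj : injective f) (f_convex : convex_position f).

(** The form in which convexity is used below: a wrong sign of an orientation turns [barycentric]
    into such a combination and forces two distinct vertices to coincide. *)
Lemma combination_range (x y z t : V) (a b c : R) : 0 < a -> 0 <= b -> 0 <= c ->
  (a + b + c) *: f t = a *: f x + b *: f y + c *: f z -> x = t.
Proof.
move=> a0 b0 c0 tE; apply: f_inj.
apply: (corner_combination3 (f_convex t) _ _ _ a0 b0 c0 tE).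
- by exists x.
- by exists y.
- by exists z.
Qed.

(* If the points were collinear, one of them would be a convex combination of
   the other two. *)
Lemma orient_neq0 (x y z : V) : x != y -> y != z -> x != z ->
  orient (f x) (f y) (f z) != 0.
Proof.
move=> xy yz xz; apply/negP => /eqP o0.
(* Here [n] is the squared length of [z - x] and [m] the inner product of [y - x] with [z - x], so
   [y] sits at parameter [m / n] on the line from [x] to [z]. The signs of [m] and [n - m] tell
   which of the three points lies between the others. *)
pose n := ((f z).1 - (f x).1) ^+ 2 + ((f z).2 - (f x).2) ^+ 2.
pose m := ((f y).1 - (f x).1) * ((f z).1 - (f x).1) +
          ((f y).2 - (f x).2) * ((f z).2 - (f x).2).
have yE : n *: f y = (n - m) *: f x + m *: f z.
  rewrite /n /m; move: o0; rewrite /orient.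
  case: (f x) (f y) (f z) => [x1 x2] [y1 y2] [z1 z2] /= o0.
  congr pair; rewrite /=/GRing.scale/=; apply/eqP; rewrite -subr_eq0; apply/eqP.
    by transitivity (((y1 - x1) * (z2 - x2) - (y2 - x2) * (z1 - x1)) * (z2 - x2));
      [ring | rewrite o0 mul0r].
  by transitivity (((y1 - x1) * (z2 - x2) - (y2 - x2) * (z1 - x1)) * (x1 - z1));
    [ring | rewrite o0 mul0r].
have n0 : 0 < n.
  rewrite lt_def /n addr_ge0 ?sqr_ge0 // andbT paddr_eq0 ?sqr_ge0 //.
  rewrite !sqrf_eq0 !subr_eq0; apply: contra xz => /andP[/eqP e1 /eqP e2].
  by apply/eqP/f_inj; rewrite [LHS]surjective_pairing -e1 -e2 -surjective_pairing.
have [m0|m0] := leP 0 m; last first.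
  move/eqP: xy; apply; apply/esym/(@combination_range y z z x n (- m) 0) => //.
    by rewrite oppr_ge0 ltW.
  by rewrite addr0 scale0r addr0 yE scalerBl scaleNr addrK.
have [nm|nm] := leP n m.
  move/eqP: yz; apply; apply/(@combination_range y x x z n (m - n) 0) => //.
    by rewrite subr_ge0.
  by rewrite addr0 scale0r addr0 yE subrKC -(opprB n m) scaleNr addrAC subrr add0r.
move/eqP: xy; apply; apply: (@combination_range x z z y (n - m) m 0) => //.
  by rewrite subr_gt0.
by rewrite addr0 scale0r addr0 subrK.
Qed.

Lemma orient_total (x y z : V) : x != y -> y != z -> x != z ->
  0 < orient (f x) (f y) (f z) \/ 0 < orient (f x) (f z) (f y).
Proof.
move=> xy yz xz; rewrite (orientC (f x) (f y) (f z)) oppr_gt0.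
by move: (orient_neq0 xy yz xz); rewrite neq_lt => /orP[]; [right|left].
Qed.

(** Otherwise [w] would lie in the triangle [x y z]. *)
Lemma orient_trans (w x y z : V) : x != w ->
    0 < orient (f w) (f x) (f y) -> 0 < orient (f w) (f y) (f z) ->
  0 < orient (f w) (f x) (f z).
Proof.
move=> xw wxy wyz; rewrite ltNge; apply/negP => wxz.
move/eqP: xw; apply.
apply: (@combination_range x y z w (orient (f y) (f z) (f w))
  (orient (f z) (f x) (f w)) (orient (f x) (f y) (f w))); rewrite ?orient_add -?barycentric //.
- by rewrite orient_rot.
- by rewrite orient_rot orientC oppr_ge0.
- by rewrite orient_rot ltW.
Qed.

(** Otherwise [y] would lie in the triangle [x z w]. Hence the middle vertex [y] and [w] are on
    opposite sides of the line [x z]. *)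
Lemma orient_between (w x y z : V) : x != y ->
    0 < orient (f w) (f x) (f y) -> 0 < orient (f w) (f y) (f z) ->
    0 < orient (f w) (f x) (f z) ->
  0 < orient (f z) (f x) (f y).
Proof.
move=> xy wxy wyz wxz; rewrite ltNge; apply/negP => zxy.
move/eqP: xy; apply.
apply: (@combination_range x z w y (orient (f z) (f w) (f y))
  (orient (f w) (f x) (f y)) (orient (f x) (f z) (f y))) => //.
- by rewrite -orient_rot.
- exact: ltW.
- by rewrite orient_swap oppr_ge0.
by rewrite [X in X *: _](orient_add (f x) (f z) (f w)) barycentric.
Qed.

End ConvexPosition.

(** * Non-edges enclosed by four edges *)

Section Obstruction.
Variables (R : realType) (V : finType) (e : rel V) (f : V -> R * R).
Hypotheses (e_sym : symmetric e) (f_rep : outside_obstacle_rep e f)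
  (f_convex : convex_position f).

Lemma orient_gt0_neq (x y z : V) :
  0 < orient (f x) (f y) (f z) -> (x != y) * (y != z) * (x != z).
Proof.
by move=> xyz; do !split; apply: contraTneq xyz => ->; rewrite /orient -leNgt; lra.
Qed.

(** By [orient_between], [u] and [w] are on opposite sides of [x y], so the four edges enclose the
    non-edge and every point of it off the drawing has a bounded component. *)
Lemma no_quadrilateral (w x u y : V) :
    e x w -> e w y -> e x u -> e u y -> ~~ e x y ->
    0 < orient (f w) (f x) (f u) -> 0 < orient (f w) (f u) (f y) -> False.
Proof.
case: f_rep => f_inj _ f_out exw ewy exu euy nxy wxu wuy.
have [[wx xu] _] := orient_gt0_neq wxu.
have wxy : 0 < orient (f w) (f x) (f y).
  by apply: (orient_trans f_inj f_convex _ wxu wuy); rewrite eq_sym.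
have [[_ xy] _] := orient_gt0_neq wxy.
have yxu : 0 < orient (f y) (f x) (f u).
  exact: (orient_between f_inj f_convex xu wxu wuy wxy).
have [z [xyz [Dz]]] := f_out x y xy nxy; apply.
have edge a b : e a b -> segment (f a) (f b) `<=` drawing_set e f.
  by move=> eab t abt; right; exists a, b.
have xyw : 0 < orient (f x) (f y) (f w) by rewrite orient_rot.
rewrite segmentC in xyz.
apply: (quadrilateral_component_bounded yxu xyw _ _ _ _ xyz Dz); apply: edge.
- by rewrite e_sym.
- by rewrite e_sym.
- by rewrite e_sym.
- by rewrite e_sym.
Qed.

(** The angular order around [w] is total and transitive on the other vertices, so a minimum is
    found by induction on the list. *)
Lemma exists_min (w : V) (s : seq V) : s != [::] -> w \notin s ->
  exists2 a, a \in s & {in s, forall v, v != a -> 0 < orient (f w) (f a) (f v)}.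
Proof.
case: f_rep => f_inj _ _.
elim: s => // x s IH _; rewrite inE negb_or => /andP[wx ws].
have [->|s0] := eqVneq s [::].
  by exists x; rewrite ?mem_head // => v; rewrite inE => ->.
have [a as_ amin] := IH s0 ws.
have [xa|xa] := eqVneq x a.
  exists a; rewrite ?inE ?as_ ?orbT // => v.
  by rewrite inE => /predU1P[->|/amin//]; rewrite xa eqxx.
have wa : w != a by apply: contraNneq ws => ->.
have [wxa|wax] := orient_total f_inj f_convex wx xa wa.
  exists x; rewrite ?mem_head // => v; rewrite inE => /predU1P[->|vs vx]; first by rewrite eqxx.
  have [->//|va] := eqVneq v a.
  by apply: (orient_trans f_inj f_convex _ wxa (amin _ vs va)); rewrite eq_sym.
by exists a; rewrite ?inE ?as_ ?orbT // => v; rewrite inE => /predU1P[->|/amin].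
Qed.

(** Intended for consecutive cycle vertices [q], [a], [p], [j]; the blocked non-edge depends on the
    order of [q] and [j] around [w]. *)
Lemma no_nonedge_path (w a p q j : V) :
    e w a -> e w p -> e w q -> e w j ->
    ~~ e a q -> ~~ e p j -> e p q -> e a j -> e q j -> q != j ->
    0 < orient (f w) (f a) (f j) -> 0 < orient (f w) (f p) (f q) -> False.
Proof.
case: f_rep => f_inj _ _ ewa ewp ewq ewj naq npj epq eaj eqj qj waj wpq.
have [[_ _] wq] := orient_gt0_neq wpq.
have [[_ _] wj] := orient_gt0_neq waj.
have [wqj|wjq] := orient_total f_inj f_convex wq qj wj.
  by apply: no_quadrilateral npj wpq wqj; rewrite // e_sym.
by apply: no_quadrilateral naq waj wjq; rewrite // e_sym.
Qed.

End Obstruction.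

(** * Cycles of length at least five that miss a vertex *)

Lemma complete_minus_cycle_rot (V : finType) (c : seq V) m : uniq c ->
  complete_minus_cycle (rot m c) =2 complete_minus_cycle c.
Proof. by move=> uc x y; rewrite /complete_minus_cycle /= !next_rot. Qed.

Lemma complete_minus_cycle_notin (V : finType) (c : seq V) (w x : V) :
  w \notin c -> x \in c -> complete_minus_cycle c w x.
Proof.
move=> wc xc; rewrite /complete_minus_cycle /= {1}next_nth (negbTE wc).
have wx : w != x by apply: contraNneq wc => ->.
rewrite wx /=; apply: contraNneq wc => <-; rewrite mem_next //.
Qed.

Lemma long_cycle_no_convex_OOR (R : realType) (V : finType) (c : seq V) (w : V) :
    uniq c -> (5 <= size c)%N -> w \notin c ->
  ~ has_convex_OOR R (complete_minus_cycle c).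
Proof.
move=> uc c5 wc [f [f_rep f_convex]].
have [|a ac amin] := exists_min f_rep f_convex _ wc.
  by case: (c) c5.
(* Rotating the cycle to start two steps before [a] makes [a] the entry [x2], with neighbours [x1],
   [x3] and second neighbours [x0], [x4]. *)
have pac : prev c (prev c a) \in c by rewrite !mem_prev.
have [m s cE] := rot_to pac.
have e_w x : x \in c -> complete_minus_cycle c w x by exact: complete_minus_cycle_notin.
have aE : next (rot m c) (next (rot m c) (prev c (prev c a))) = a.
  by rewrite !next_rot // !next_prev.
have eE := complete_minus_cycle_rot m uc.
have e_sym := complete_minus_cycle_sym c.
have memE x : (x \in c) = (x \in rot m c) by rewrite mem_rot.
have ur : uniq (rot m c) by rewrite rot_uniq.
have size_r : (5 <= size (rot m c))%N by rewrite size_rot.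
move: aE eE memE ur size_r; rewrite {}cE; set x0 := prev c _.
case: s => [|x1 [|x2 [|x3 [|x4 s]]]] // aE eE memE ur _.
have := ur; rewrite /= !inE !negb_or => /and5P[].
move=> /and5P[/negbTE x01 /negbTE x02 /negbTE x03 /negbTE x04 /negbTE x0s].
move=> /and4P[/negbTE x12 /negbTE x13 /negbTE x14 /negbTE x1s].
move=> /and3P[/negbTE x23 /negbTE x24 x2s] /andP[/negbTE x34 _] _.
have x2a : x2 = a by move: aE; rewrite /= eqxx eq_sym x01 eqxx.
move: (amin); rewrite -x2a => {}amin.
have mem0 : x0 \in c by rewrite memE !inE eqxx.
have mem1 : x1 \in c by rewrite memE !inE eqxx ?orbT.
have mem2 : x2 \in c by rewrite memE !inE eqxx ?orbT.
have mem3 : x3 \in c by rewrite memE !inE eqxx ?orbT.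
have mem4 : x4 \in c by rewrite memE !inE eqxx ?orbT.
have nextE : (next [:: x0, x1, x2, x3, x4 & s] x0 = x1) *
    (next [:: x0, x1, x2, x3, x4 & s] x1 = x2) *
    (next [:: x0, x1, x2, x3, x4 & s] x2 = x3) *
    (next [:: x0, x1, x2, x3, x4 & s] x3 = x4) *
    (next [:: x0, x1, x2, x3, x4 & s] x4 = head x0 s).
  rewrite /= !eqxx !(eq_sym _ x0) x01 x02 x03 x04 !(eq_sym _ x1) x12 x13 x14.
  rewrite (eq_sym _ x2) x23 (eq_sym _ x2) x24 (eq_sym _ x3) x34.
  by case: (s) => [|y s'] /=; rewrite eqxx.
have e_edge x y : complete_minus_cycle c x y =
    [&& x != y, next [:: x0, x1, x2, x3, x4 & s] x != y
      & next [:: x0, x1, x2, x3, x4 & s] y != x].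
  by rewrite -eE.
(* The successor of [x4] is [x0] when the cycle has length five and the head of [s] otherwise; in
   both cases [x4] is joined to [x1] and [x2]. *)
have h2 : head x0 s == x2 = false.
  case: (s) x2s => [_|y s' /=]; first by rewrite x02.
  by rewrite inE eq_sym => /norP[/negbTE].
have h1 : head x0 s == x1 = false.
  case: (s) x1s => [_|y s' /=]; first by rewrite x01.
  by rewrite inE eq_sym => /norP[/negbTE].
have neq := (eqxx, x01, x02, x03, x04, x12, x13, x14, x23, x24, x34, h1, h2,
  eq_sym x1 x0, eq_sym x2 x0, eq_sym x3 x0, eq_sym x4 x0, eq_sym x2 x1,
  eq_sym x3 x1, eq_sym x4 x1, eq_sym x3 x2, eq_sym x4 x2, eq_sym x4 x3, andbF).
have wlt x : x \in c -> x2 != x -> 0 < orient (f w) (f x2) (f x).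
  by move=> xc xx2; apply: amin; rewrite // eq_sym.
have path := no_nonedge_path e_sym f_rep f_convex.
have [f_inj _ _] := f_rep.
have x1w : w != x1 by apply: contraNneq wc => ->.
have x3w : w != x3 by apply: contraNneq wc => ->.
(* The neighbour of [a] that comes first around [w] plays [p], and [j] is [x0] or [x4]
   accordingly. *)
have [w13|w31] := orient_total f_inj f_convex x1w (negbT x13) x3w.
  by apply: (path w x2 x1 x3 x0) w13; rewrite ?e_w // ?e_edge ?nextE ?neq // wlt ?neq.
by apply: (path w x2 x3 x1 x4) w31; rewrite ?e_w // ?e_edge ?nextE ?neq // wlt ?neq.
Qed.

(** * Points on a parabola are in convex position *)

Section Parabola.
Variable R : realType.

Definition parabola (t : R) : R * R := (t, t ^+ 2).

Lemma parabola_inj : injective parabola.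
Proof. by move=> s t []. Qed.

(** The vertical height of [z] above the tangent to the parabola at abscissa [t]. *)
Definition tangent_gap (t : R) (z : R * R) : R := z.2 - t *+ 2 * z.1 + t ^+ 2.

Lemma tangent_gap_conv (t s : R) (p q : R * R) :
  tangent_gap t ((1 - s) *: p + s *: q) =
  (1 - s) * tangent_gap t p + s * tangent_gap t q.
Proof. by rewrite /tangent_gap /=/GRing.scale/=; ring. Qed.

Lemma tangent_gap_parabola (t s : R) : tangent_gap t (parabola s) = (s - t) ^+ 2.
Proof. by rewrite /tangent_gap /parabola /=; ring. Qed.

Lemma parabola_convex_position (V : finType) (g : V -> R) :
  convex_position (parabola \o g).
Proof.
move=> x; pose t := g x; split.
  by apply: subset_convex_hull; exists x.
(* The open half-plane above the tangent together with the point of tangency: a convex set that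
   contains all the points, hence their hull, and has that point as an extreme point. *)
pose C : set (R * R) := [set z | 0 <= tangent_gap t z /\
                             (tangent_gap t z = 0 -> z = parabola t)].
have combination p q (s : R) : C p -> C q -> 0 < s < 1 ->
    tangent_gap t ((1 - s) *: p + s *: q) = 0 -> p = parabola t /\ q = parabola t.
  move=> [p0 pE] [q0 qE] /andP[s0 s1]; rewrite tangent_gap_conv.
  have s1' : 0 < 1 - s by rewrite subr_gt0.
  move/eqP; rewrite paddr_eq0 ?mulr_ge0 ?(ltW s0) ?(ltW s1') //.
  rewrite !mulf_eq0 (gt_eqF s0) (gt_eqF s1') /= => /andP[/eqP/pE -> /eqP/qE ->].
  by [].
have C_convex : convex_set C.
  apply/convex_setW => p q /set_mem Cp /set_mem Cq k k0 k1; apply/mem_set.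
  have -> : conv k p q = (1 - k%:num) *: (q : R * R) + k%:num *: (p : R * R).
    by rewrite /conv /= addrC.
  have k01 : 0 < k%:num < 1 by rewrite k0 k1.
  split.
    rewrite tangent_gap_conv addr_ge0 // mulr_ge0 ?(ltW k0) ?subr_ge0 ?(ltW k1) //.
      exact: Cq.1.
    exact: Cp.1.
  move=> /(combination _ _ _ Cq Cp k01)[-> ->].
  by rewrite -scalerDl subrK scale1r.
have hull_C : convex_hull (range (parabola \o g)) `<=` C.
  move=> z; apply; split=> // _ [v _ <-] /=.
  rewrite /C /= tangent_gap_parabola sqr_ge0; split=> // /eqP.
  by rewrite sqrf_eq0 subr_eq0 => /eqP ->.
move=> p q s /hull_C Cp /hull_C Cq s01 zE.
apply: (combination p q s) => //.
by rewrite -zE tangent_gap_parabola subrr expr0n.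
Qed.

Lemma parabola_chord (a b s t : R) : (1 - s) * a + s * b = t ->
  (1 - s) * a ^+ 2 + s * b ^+ 2 = t ^+ 2 + (t - a) * (b - t).
Proof. by move=> <-; ring. Qed.

End Parabola.

Arguments parabola {R} t.

(** * Vertical rays to the outer face *)

Section VerticalRays.
Variables (R : realType) (V : finType) (e : rel V).

Lemma convex_position_edge (f : V -> R * R) (x y z : V) : injective f ->
  convex_position f -> segment (f x) (f y) (f z) -> z = x \/ z = y.
Proof.
move=> f_inj f_convex /segmentP[t /andP[]].
rewrite le_eqVlt => /predU1P[<- _|t0].
  by rewrite subr0 scale1r scale0r addr0 => /f_inj; left.
rewrite le_eqVlt => /predU1P[->|t1].
  by rewrite subrr scale0r add0r scale1r => /f_inj; right.
move=> zE; left; apply: f_inj.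
have [_ ext] := f_convex z.
have hull v : convex_hull (range f) (f v) by apply: subset_convex_hull; exists v.
by have [|-> _] := ext _ _ t (hull x) (hull y) _ zE; rewrite ?t0.
Qed.

(** The ray is connected, unbounded and off the drawing, so it lies in an unbounded component. The
    sign of [d] selects up or down. *)
Lemma vertical_ray_outer_face (f : V -> R * R) (t h d : R) : d != 0 ->
    (forall s, 0 <= s -> ~ drawing_set e f (t, h + d * s)) ->
  outer_face e f (t, h).
Proof.
move=> d0 ray; split.
  by have := ray 0 (lexx _); rewrite mulr0 addr0.
pose r (s : R) : R * R := (t, h + d * s).
have r_cont : continuous r.
  move=> s; apply: (@cvg_pair _ _ _ _ (nbhs t) (nbhs (h + d * s))); first exact: cvg_cst.
  by apply: cvgD; [exact: cvg_cst | apply: cvgM; [exact: cvg_cst | exact: cvg_id]].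
have sub : r @` [set s | 0 <= s] `<=` connected_component (~` drawing_set e f) (t, h).
  apply: connected_component_max.
  - by exists 0; rewrite /r ?mulr0 ?addr0 //=.
  - by move=> _ [s s0 <-]; exact: ray.
  apply: connected_continuous_connected; last exact: continuous_subspaceT.
  by apply/connected_intervalP => a b /= a0 b0 c /andP[ac _]; exact: le_trans ac.
move=> [M [_ bound]].
pose N := `|M| + 1.
have MN : M < N by rewrite /N (le_lt_trans (ler_norm M)) // ltrDl.
have N0 : 0 <= N by rewrite /N addr_ge0.
(* Chosen so that the second coordinate [h + d * s] has absolute value at least [N + 1]. *)
pose s := (N + `|h| + 1) / `|d|.
have s0 : 0 <= s by rewrite divr_ge0 // !addr_ge0.
have := bound N MN (r s) (sub _ (ex_intro2 _ _ s s0 erefl)).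
rewrite /= prod_normE /= ge_max => /andP[_]; apply/negP; rewrite -ltNge.
have dsE : `|d * s| = N + `|h| + 1.
  by rewrite normrM (ger0_norm s0) /s mulrCA divff ?mulr1 // normr_eq0.
have := lerB_normD (d * s) h; rewrite dsE [d * s + h]addrC; lra.
Qed.

Variable g : V -> R.
Hypothesis e_sym : symmetric e.

Lemma drawing_set_vertical (t h : R) : (forall v, g v != t) ->
    drawing_set e (parabola \o g) (t, h) ->
  exists a b, [/\ e a b, g a < t < g b & h = t ^+ 2 + (t - g a) * (g b - t)].
Proof.
move=> gt [[v _ [/eqP]]|[a [b [eab]]]]; first by rewrite (negPf (gt v)).
wlog ab : a b eab / g a <= g b.
  move=> th; case: (leP (g a) (g b)) => [|/ltW ba]; first exact: th.
  by rewrite segmentC; apply: th; rewrite // e_sym.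
move=> /segmentP[s /andP[]]; rewrite le_eqVlt => /predU1P[<- _|s0].
  by rewrite subr0 scale1r scale0r addr0 => -[/esym/eqP]; rewrite (negPf (gt a)).
rewrite le_eqVlt => /predU1P[->|s1].
  by rewrite subrr scale1r scale0r add0r => -[/esym/eqP]; rewrite (negPf (gt b)).
rewrite /parabola /= => -[tE hE]; exists a, b.
split=> //; last by rewrite hE; exact: parabola_chord.
have ab_s : 0 <= s * (g b - g a) by rewrite mulr_ge0 ?subr_ge0 // ltW.
have ab_s' : 0 <= (1 - s) * (g b - g a) by rewrite mulr_ge0 ?subr_ge0 // ltW.
have {}tE : t = (1 - s) * g a + s * g b by [].
by rewrite !lt_neqAle gt (eq_sym t) gt /=; apply/andP; split; lra.
Qed.

(** At abscissa [t] the chord lies strictly below all edges, and the ray goes down, or strictly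
    above all of them, and it goes up. *)
Lemma chord_meets_outer_face (x y : V) (t : R) :
    (forall v, g v != t) -> g x < t < g y ->
    (forall a b, e a b -> g a < t < g b ->
       (t - g x) * (g y - t) < (t - g a) * (g b - t)) \/
    (forall a b, e a b -> g a < t < g b ->
       (t - g a) * (g b - t) < (t - g x) * (g y - t)) ->
  segment (parabola (g x)) (parabola (g y)) `&` outer_face e (parabola \o g) !=set0.
Proof.
move=> gt /andP[xt ty] hyp.
pose h := t ^+ 2 + (t - g x) * (g y - t); exists (t, h); split.
  apply/segmentP; have xy : 0 < g y - g x by lra.
  exists ((t - g x) / (g y - g x)).
    by rewrite divr_ge0 ?ler_pdivrMr ?mul1r //=; lra.
  have tE : (1 - (t - g x) / (g y - g x)) * g x + (t - g x) / (g y - g x) * g y = t.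
    by field; rewrite lt0r_neq0.
  by congr pair; rewrite /= /GRing.scale /=; [rewrite tE | rewrite (parabola_chord tE)].
case: hyp => hyp; [apply: (@vertical_ray_outer_face _ _ _ (-1)) |
                   apply: (@vertical_ray_outer_face _ _ _ 1)];
  rewrite ?oppr_eq0 ?oner_eq0 // => s s0 /(drawing_set_vertical gt)[a [b [eab atb hE]]];
  by have := hyp a b eab atb; rewrite /h in hE; lra.
Qed.

End VerticalRays.

(* The vertex x is placed at abscissa pos x, and N lists the non-edges by
   position.  The witness m + s is the abscissa of a vertical ray towards the
   outer face, downwards in the first alternative and upwards in the second:
   (t - a) (b - t) is the height at t of the chord ab above the parabola. *)
Lemma layout_convex_OOR (R : realType) (V : finType) (e : rel V) (pos : V -> nat)
    (N : rel nat) (M : nat) :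
    symmetric e -> injective pos ->
    (forall x y, (pos x < pos y)%N -> e x y = ~~ N (pos x) (pos y)) ->
    (forall i j, (i < j)%N -> N i j -> exists m (s : R),
       [/\ 0 < s < 1, (i <= m < j)%N &
        let t := m%:R + s in
        (forall a b, (a <= m < b)%N -> ~~ N a b ->
           (t - i%:R) * (j%:R - t) < (t - a%:R) * (b%:R - t)) \/
        (forall a b, (a <= m < b)%N -> ~~ N a b -> (b < M)%N ->
           (t - a%:R) * (b%:R - t) < (t - i%:R) * (j%:R - t))]) ->
    (forall x, (pos x < M)%N) ->
  has_convex_OOR R e.
Proof.
move=> e_sym pos_inj eE wit pos_lt.
pose g x : R := (pos x)%:R.
have g_inj : injective g by move=> x y /eqP; rewrite eqr_nat => /eqP/pos_inj.
exists (parabola \o g); split; last exact: parabola_convex_position.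
have f_inj : injective (parabola \o g) by move=> x y /parabola_inj/g_inj.
split=> //.
  move=> x y z _; apply: convex_position_edge => //; exact: parabola_convex_position.
move=> x y; wlog xy : x y / (pos x < pos y)%N.
  move=> th xy nxy; case: (ltngtP (pos x) (pos y)) => [|yx|/pos_inj/eqP].
  - by move/th; apply.
  - by rewrite segmentC; apply: th; rewrite // 1?eq_sym // e_sym.
  by rewrite (negPf xy).
move=> _; rewrite eE // negbK => Nxy.
have [m [s [/andP[s0 s1] /andP[xm my] hyp]]] := wit _ _ xy Nxy.
have below (i : nat) : (i%:R < m%:R + s) = (i <= m)%N.
  apply/idP/idP => [im|]; last by rewrite -(ler_nat R) => im; lra.
  by rewrite leqNgt; apply/negP; rewrite -(ler_nat R) -natr1 => ?; lra.
have above (i : nat) : (m%:R + s < i%:R) = (m < i)%N.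
  apply/idP/idP => [im|]; last by rewrite -(ler_nat R) -natr1 => im; lra.
  by rewrite ltnNge; apply/negP; rewrite -(ler_nat R) => ?; lra.
apply: (chord_meets_outer_face (t := m%:R + s) e_sym).
- move=> v; rewrite neq_lt below above; exact: leqVgt.
- by rewrite below above xm.
case: hyp => hyp; [left|right] => a b eab; rewrite /g below above => /andP[am mb];
  have ab := leq_ltn_trans am mb; apply: hyp; rewrite ?am ?mb // -?eE //.
Qed.


(** * Layouts for cycles of length three, four and [n] *)

Section Layouts.
Variables (R : realType) (V : finType).

Lemma complete_minus_cycle_notinr (c : seq V) x y : x != y -> y \notin c ->
  complete_minus_cycle c x y.
Proof.
move=> xy yc; rewrite complete_minus_cycle_sym.
have [xc|xc] := boolP (x \in c); first exact: complete_minus_cycle_notin.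
by rewrite /complete_minus_cycle /= !next_nth (negPf xc) (negPf yc) (eq_sym y) xy.
Qed.

Lemma cycle3_convex_OOR (c0 c1 c2 : V) : uniq [:: c0; c1; c2] ->
  has_convex_OOR R (complete_minus_cycle [:: c0; c1; c2]).
Proof.
(* Cycle vertices reappear in [enum V], but [index] returns first occurrences, so they keep
   positions 0, 1, 2. *)
set c := [:: _; _; _] => uc; pose s := c ++ enum V.
have mem_s x : x \in s by rewrite mem_cat mem_enum orbT.
have mem_c x : (index x s < 3)%N = (x \in c).
  by rewrite index_cat -[3%N]/(size c); case: ifP; rewrite -index_mem // ltnNge leq_addr.
apply: (layout_convex_OOR (pos := index^~ s) (N := fun _ j => (j < 3)%N) (M := size s)).
- exact: complete_minus_cycle_sym.
- by move=> x y; apply: index_inj.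
- move=> x y xy; rewrite mem_c; have [yc|yc] := boolP (y \in c); last first.
    by apply: complete_minus_cycle_notinr => //; apply: contraTneq xy => ->; rewrite ltnn.
  have xc : x \in c by rewrite -mem_c (ltn_trans xy) // mem_c.
  move: uc xc yc; rewrite /= !inE !negb_or.
  move=> /and3P[/andP[/negbTE c01 /negbTE c02] /negbTE c12 _].
  have neq := (eqxx, c01, c02, c12, eq_sym c1 c0, eq_sym c2 c0, eq_sym c2 c1).
  by move=> /or3P[] /eqP -> /or3P[] /eqP ->; rewrite /complete_minus_cycle /= ?neq.
(* Every edge ends at position 3 or later. At the chosen abscissas the non-edges have heights 1/4,
   3/4, 1/4, and the edges at least 5/4, 5/4, 3/4. *)
- case=> [|[|i]] [|[|[|j]]] //= _ _; [exists 0, 2^-1|exists 0, 2^-1|exists 1, 2^-1];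
  split=> //; try lra; left.
  - move=> [|a] b // _; rewrite -leqNgt -(ler_nat R); lra.
  - move=> [|a] b // _; rewrite -leqNgt -(ler_nat R); lra.
  - move=> [|[|a]] b // _; rewrite -leqNgt -(ler_nat R); lra.
by move=> x; rewrite index_mem.
Qed.

Lemma cycle4_convex_OOR (c0 c1 c2 c3 : V) : uniq [:: c0; c1; c2; c3] ->
  has_convex_OOR R (complete_minus_cycle [:: c0; c1; c2; c3]).
Proof.
set c := [:: _; _; _; _] => uc; pose d := [:: c0; c1; c3; c2]; pose s := d ++ enum V.
have mem_s x : x \in s by rewrite mem_cat mem_enum orbT.
have mem_c x : (index x s < 4)%N = (x \in c).
  have -> : (x \in c) = (x \in d) by rewrite !inE; do 2!congr orb; exact: orbC.
  by rewrite index_cat -[4%N]/(size d); case: ifP; rewrite -index_mem // ltnNge leq_addr.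
(* Swapping [c2] and [c3] makes the non-edges (0, 2) and (1, 3) cross, while the edges (0, 3) and
   (1, 2) do not. *)
pose N (i j : nat) := (i, j) \in [:: (0, 1); (0, 2); (1, 3); (2, 3)]%N.
apply: (layout_convex_OOR (pos := index^~ s) (N := N) (M := size s)).
- exact: complete_minus_cycle_sym.
- by move=> x y; apply: index_inj.
- move=> x y xy; have [yc|yc] := boolP (y \in c); last first.
    rewrite complete_minus_cycle_notinr //; last by apply: contraTneq xy => ->; rewrite ltnn.
    move: yc; rewrite -mem_c -leqNgt /N !inE !xpair_eqE.
    by case: (index y s) => [|[|[|[|?]]]]; rewrite // ?andbF.
  have xc : x \in c by rewrite -mem_c (ltn_trans xy) // mem_c.
  move: uc xc yc xy.
  rewrite /= !inE !negb_or => /and4P[/and3P[/negbTE c01 /negbTE c02 /negbTE c03]].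
  move=> /andP[/negbTE c12 /negbTE c13] /negbTE c23 _.
  have neq := (eqxx, c01, c02, c03, c12, c13, c23, eq_sym c1 c0, eq_sym c2 c0,
    eq_sym c3 c0, eq_sym c2 c1, eq_sym c3 c1, eq_sym c3 c2).
  by move=> /or4P[] /eqP -> /or4P[] /eqP ->; rewrite /complete_minus_cycle /N /= ?neq.
(* The offset 3/4 is needed for (1, 3): at abscissa 5/2 its height 3/4 would tie with that of the
   chord (2, 4). *)
- rewrite /N => i j _; rewrite !inE => /or4P[] /eqP[-> ->];
   [exists 0, 2^-1|exists 0, 2^-1|exists 2, (3 / 4)|exists 2, (3 / 4)];
  (split=> //; first lra); left => -[|[|[|a]]] [|[|[|[|b]]]] //= _ _;
  rewrite -1?[b.+4]addn4 ?natrD; try (have := ler0n R b); lra.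
by move=> x; rewrite index_mem.
Qed.

Lemma spanning_cycle_convex_OOR (c : seq V) : uniq c -> (forall x, x \in c) ->
  has_convex_OOR R (complete_minus_cycle c).
Proof.
move=> uc mem_c.
pose N (i j : nat) := (j == i.+1) || (i == 0%N) && (j == (size c).-1).
apply: (layout_convex_OOR (pos := index^~ c) (N := N) (M := size c)).
- exact: complete_minus_cycle_sym.
- by move=> x y; apply: index_inj.
- move=> x y xy; have nextE z : next c z =
      nth z c (if (index z c).+1 == size c then 0 else (index z c).+1).
    (* In [next_nth] the default value is the head of the cycle, which is what closes it after the
       last position. *)
    rewrite next_nth mem_c; case: (c) (mem_c z) => // c0 c' zc.
    rewrite -[size _]/(size c').+1 eqSS; case: eqP => [->|/eqP zn]; first by rewrite nth_default.
    by apply: set_nth_default; move: zc; rewrite -index_mem /= ltnS leq_eqVlt (negPf zn).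
  have index_next z : index (next c z) c =
      if (index z c).+1 == size c then 0%N else (index z c).+1.
    rewrite nextE index_uniq //; case: eqP => [<- //|/eqP zn].
    by rewrite ltn_neqAle zn index_mem mem_c.
  have nextP z t : (next c z == t) = (index (next c z) c == index t c).
    by apply/eqP/eqP => [->//|]; apply: index_inj.
  rewrite /complete_minus_cycle /= /N !nextP !index_next.
  have ys : (index y c < size c)%N by rewrite index_mem.
  have -> /= : x != y by apply: contraTneq xy => ->; rewrite ltnn.
  move: xy ys; move: (index x c) (index y c) (size c) => i j n ij jn.
  have -> : (i.+1 == n) = false by lia.
  by case: (j.+1 =P n) => ?; lia.
- move=> i j ij /orP[/eqP ->|/andP[/eqP i0 /eqP jE]].
    (* The chord of consecutive positions has height 1/4 at its midpoint; any other chord above it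
       has one factor at least 3/2 and the other at least 1/2. *)
    exists i, 2^-1; split; [lra|by rewrite leqnn ltnS leqnn|left].
    move=> a b /andP[ai ib] Nab; rewrite -[i.+1%:R]natr1.
    have ab : (a < i)%N || (i.+1 < b)%N.
      rewrite ltn_neqAle ai ltn_neqAle ib !andbT -negb_and; apply: contra Nab.
      by move=> /andP[/eqP -> /eqP <-]; rewrite /N eqxx.
    move: ai ib; rewrite -!(ler_nat R) -[i.+1%:R]natr1 => ai ib.
    pose p : R := i%:R + 2^-1 - a%:R; pose q : R := b%:R - (i%:R + 2^-1).
    have p0 : 2^-1 <= p by rewrite /p; lra.
    have q0 : 2^-1 <= q by rewrite /q; lra.
    suff : 4^-1 < p * q by rewrite /p /q; lra.
    case/orP: ab; rewrite -(ler_nat R) -?[a.+1%:R]natr1 -?[i.+2%:R]natr1 -?[i.+1%:R]natr1 => ?.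
      have : 3 / 2 <= p by rewrite /p; lra.
      by nra.
    have : 3 / 2 <= q by rewrite /q; lra.
    by nra.
  (* The closing pair is the top side of the hull: edges over abscissa 1/2 also start at 0 but end
     before the last position, so they pass below it. *)
  exists 0, 2^-1; split; [lra|lia|right].
  rewrite i0 jE.
  move=> [|a] b // /andP[_ b0] Nab bc.
  have : (b.+1 <= (size c).-1)%N.
    by move: Nab; rewrite /N; lia.
  rewrite -(ler_nat R) -[b.+1%:R]natr1; lra.
by move=> x; rewrite index_mem.
Qed.
End Layouts.

(* The equivalence, with vertices counted against the cycle *)
Local Close Scope ring_scope.
Local Close Scope classical_set_scope.

Theorem theorem6 (R : realType) (n k : nat) (c : seq 'I_n)
    (hk3 : (3 <= k)%N) (hkn : (k <= n)%N)
    (hc : uniq c) (hck : size c = k) :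
  has_convex_OOR R (complete_minus_cycle c) <-> (k = 3 \/ k = 4 \/ k = n).
Proof.
have card_c : #|c| = k by rewrite (card_uniqP hc).
split=> [oor|].
  have [k5|] := leqP 5 k; last by lia.
  have [kn|] := ltnP k n; last by lia.
  have /existsP[w wc] : [exists w, w \notin c].
    rewrite -negb_forall; apply: contraTN kn => /forallP c_all.
    rewrite -leqNgt -card_c -[n in (n <= _)%N]card_ord subset_leq_card //.
    exact/fintype.subsetP.
  by case: (long_cycle_no_convex_OOR hc _ wc oor); rewrite hck.
case=> [k3|[k4|kn]].
- move: hc hck; rewrite k3; case: (c) => [|c0 [|c1 [|c2 [|]]]] // uc _.
  exact: cycle3_convex_OOR.
- move: hc hck; rewrite k4; case: (c) => [|c0 [|c1 [|c2 [|c3 [|]]]]] // uc _.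
  exact: cycle4_convex_OOR.
apply: spanning_cycle_convex_OOR => // x.
have /subset_cardP : #|c| = #|'I_n| by rewrite card_c kn card_ord.
by move=> /(_ (subset_predT _)) ->.
Qed.
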